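(* Let $\circ\in\{\cap,\cup,\oplus\}$ and let $m,n,p\geq 3$ be integers. Put $k=1$ if $\circ=\cap$, $k=m+n-1$ if $\circ=\cup$, and $k=m+n-2$ if $\circ=\oplus$. Then $$\mathrm{sc}_{(\star\circ\star)\cdot\star}(m,n,p)=(mn-k)2^{p}+k2^{p-1}.$$ In all cases the bound is reached by the triple of languages over the three-letter alphabet $\{a,b,c\}$ recognized by the automata $$\left(\mathcal X_{m}(a,b,-;\{c\}),\ \mathcal X_{n}(a,c,-;\{b\}),\ \mathcal X_{p}(a,-,b;\{c\})\right);$$ that is, writing $L_1,L_2,L_3$ for these languages, $\mathrm{sc}((L_1\circ L_2)\cdot L_3)=(mn-k)2^{p}+k2^{p-1}$.
   Context: For a regular language $L$ over a finite alphabet $\Sigma$, $\mathrm{sc}(L)$ denotes the number of states of its minimal complete deterministic finite automaton (DFA) over $\Sigma$. For a ternary operation $\otimes$ on languages, $\mathrm{sc}_\otimes(m,n,p)=\max \mathrm{sc}(\otimes(L_1,L_2,L_3))$, the maximum being over all finite alphabets $\Sigma$ and all regular languages $L_1,L_2,L_3$ over the same alphabet $\Sigma$ with $\mathrm{sc}(L_1)=m$, $\mathrm{sc}(L_2)=n$, $\mathrm{sc}(L_3)=p$. The operation $(\star\circ\star)\cdot\star$ is $(L_1,L_2,L_3)\mapsto (L_1\circ L_2)\cdot L_3$, where $\cdot$ is catenation; $\oplus$ is symmetric difference. $\mathcal X_n(\sigma_1,\sigma_2,\sigma_3;\Sigma\setminus\{\sigma_1,\sigma_2,\sigma_3\})$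 is the complete DFA over $\Sigma$ with state set $\{0,\dots,n-1\}$, initial state $0$, unique final state $n-1$, in which the letter $\sigma_1$ acts as the cycle $(0,1,\dots,n-1)$ (i.e. $q\mapsto q+1 \bmod n$), $\sigma_2$ acts as the transposition exchanging $0$ and $1$, $\sigma_3$ acts as the contraction sending $1$ to $0$ and fixing all other states, and all other letters act as the identity; a ''$-$'' in place of $\sigma_i$ means that no letter plays that role. *)

(* Defs.v *)
From HB Require Import structures.
From mathcomp Require Import all_boot.
From mathcomp Require Import classical_sets.

Set Implicit Arguments.
Unset Strict Implicit.
Unset Printing Implicit Defensive.

Local Open Scope classical_set_scope.

Definition language (A : finType) : Type := set (seq A).

Record dfa (A : finType) : Type := Dfa {
  state : finType;
  init : state;
  step : state -> A -> state;
  final : pred state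
}.

Definition lang (A : finType) (M : dfa A) : language A :=
  [set w | final (foldl (@step A M) (init M) w)].

Definition minimal_dfa (A : finType) (M : dfa A) : Prop :=
  forall M' : dfa A, lang M' = lang M -> #|state M| <= #|state M'|.

(** [has_sc L n]: the language [L] is regular and sc(L) = n.  The alphabet is
    part of the type of [L]. *)
Definition has_sc (A : finType) (L : language A) (n : nat) : Prop :=
  exists M : dfa A, [/\ lang M = L, minimal_dfa M & #|state M| = n].

(** A ternary operation on languages, given uniformly in the alphabet. *)
Definition ternary_op : Type :=
  forall A : finType, language A -> language A -> language A -> language A.

(** [has_sc_op op m n p N]: the maximum defining sc_op(m,n,p) exists and equals
    [N].  The second clause also asserts that [op] yields a regular language
    on all admissible arguments, so that their state complexity is defined. *)
Definition has_sc_op (op : ternary_op) (m n p N : nat) : Prop :=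
  (exists (A : finType) (L1 L2 L3 : language A),
     [/\ has_sc L1 m, has_sc L2 n, has_sc L3 p & has_sc (op A L1 L2 L3) N]) /\
  (forall (A : finType) (L1 L2 L3 : language A),
     has_sc L1 m -> has_sc L2 n -> has_sc L3 p ->
     exists2 N' : nat, has_sc (op A L1 L2 L3) N' & N' <= N).

Definition conc (A : finType) (K L : language A) : language A :=
  [set u ++ v | u in K & v in L].

Variant boolop := Cap | Cup | SymDiff.

Definition apply_boolop (o : boolop) (A : finType) (K L : language A) :
    language A :=
  match o with
  | Cap => K `&` L
  | Cup => K `|` L
  | SymDiff => K `+` L
  end.

Definition boolop_conc (o : boolop) : ternary_op :=
  fun A L1 L2 L3 => conc (apply_boolop o L1 L2) L3.

(** The state set is written ['I_n.-1.+1], which is {0, ..., n-1} for every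
    n > 0, so that the initial state can be [ord0] without a positivity proof;
    [n] is always at least 3 in use, so [inord 1] is the state 1.
    The roles are optional letters, [None] standing for "-"; every letter
    playing no role acts as the identity. *)
Definition X_step (n : nat) (A : finType) (s1 s2 s3 : option A)
    (q : 'I_n.-1.+1) (x : A) : 'I_n.-1.+1 :=
  if Some x == s1 then ordS q
  else if Some x == s2 then
    (if q == ord0 then inord 1 else if q == inord 1 then ord0 else q)
  else if Some x == s3 then
    (if q == inord 1 then ord0 else q)
  else q.

Definition X_dfa (n : nat) (A : finType) (s1 s2 s3 : option A) : dfa A :=
  {| state := 'I_n.-1.+1;
     init := ord0;
     step := X_step s1 s2 s3;
     final := fun q => q == ord_max |}.

Variant letter := La | Lb | Lc.

Definition letter_to_ord (x : letter) : 'I_3 :=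
  match x with
  | La => @Ordinal 3 0 isT
  | Lb => @Ordinal 3 1 isT
  | Lc => @Ordinal 3 2 isT
  end.

Definition letter_of_ord (i : 'I_3) : letter :=
  match val i with 0 => La | 1 => Lb | _ => Lc end.

Lemma letter_to_ordK : cancel letter_to_ord letter_of_ord.
Proof. by case. Qed.

HB.instance Definition _ := Finite.copy letter (can_type letter_to_ordK).

(* Main.v *)
Require Import Defs.
From HB Require Import structures.
From mathcomp Require Import all_boot.
From mathcomp Require Import classical_sets.
From mathcomp Require Import boolp zify.

Set Implicit Arguments.
Unset Strict Implicit.
Unset Printing Implicit Defensive.

(** A DFA for (L1 o L2) L3 has as states the triples (i, j, S), with S a set of
    states of M3 that contains the initial one whenever (i, j) is accepting;
    counting them gives the upper bound once the number of accepting pairs is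
    minimised, a minimal DFA with at least two states having between 1 and
    m - 1 final ones.

    For the witness every triple is reachable, by induction on |S|.  An
    accepting (i, j, S) comes under [a] from a triple with a smaller set.  From
    a nonaccepting one, walk backwards with [a], using [b] and [c] to replace a
    coordinate 0 by 1 beforehand, so that (i, j) decreases to (0, 0) without
    meeting an accepting pair (for S empty this is the initial state); [b] may be
    undone as long as 1 is not in S.  The
    walk is obstructed only when i = 0 and 1 is in S, and then one more
    backward [a] reaches an accepting pair, or, for the intersection, at least
    decreases j.

    Two triples with different sets are separated by a power of [a].  If the
    sets agree, powers of [abb] collapse them into {0}; from then on [abb], [b]
    and [c] act on the pairs through all of S_m x S_n, and some permutation
    makes one pair accepting and the other one not. *)

(** * Runs, indistinguishable states and minimality of a DFA *)

Definition run (A : finType) (M : dfa A) (q : state M) (w : seq A) : state M :=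
  foldl (@step A M) q w.

Definition indist (A : finType) (M : dfa A) (q r : state M) : Prop :=
  forall w, final (run q w) = final (run r w).

Lemma indist_step (A : finType) (M : dfa A) (q r : state M) x :
  indist q r -> indist (step q x) (step r x).
Proof. by move=> E w; exact: (E (x :: w)). Qed.

(** Choose a word leading to each state and run [M'] on it. Two words that meet in [M'] have the
    same accepted continuations, so separation makes this map of states injective. *)
Lemma minimal_dfa_of_accessible_separated (A : finType) (M : dfa A) :
  (forall q : state M, exists w, run (init M) w = q) ->
  (forall q r : state M, indist q r -> q = r) ->
  minimal_dfa M.
Proof.
move=> acc sep M' eqL.
have [word wordP] := choice acc.
apply: (@leq_card _ _ (fun q => run (init M') (word q))) => q r eq_qr.
apply: sep => w; rewrite -{1}(wordP q) -(wordP r) /run -!foldl_cat.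
have L' v : final (run (init M') v) = final (run (init M) v).
  have e : lang M' v = lang M v by rewrite eqL.
  by apply/idP/idP; [rewrite -[is_true _]/(lang M' v) e
                    |rewrite -[X in X -> _]/(lang M v) -e].
rewrite -!/(run _ _) -!L' /run !foldl_cat.
by rewrite -/(run (init M') (word q)) eq_qr.
Qed.

Lemma has_sc_of_lang (A : finType) (M : dfa A) :
  exists2 N, has_sc (lang M) N & N <= #|state M|.
Proof.
pose P n := `[< exists M' : dfa A, lang M' = lang M /\ #|state M'| = n >].
have exP : exists n, P n by exists #|state M|; apply/asboolP; exists M.
case: (ex_minnP exP) => N /asboolP[M' [eqL card_M']] minN.
exists N; last by apply: minN; apply/asboolP; exists M.
exists M'; split=> // M'' eqL''; rewrite card_M'.
by apply: minN; apply/asboolP; exists M''; rewrite eqL'' eqL.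
Qed.

(** If no state or every state were final, the language would be empty or full, and one state would
    suffice. *)
Lemma minimal_dfa_final_card (A : finType) (M : dfa A) :
  minimal_dfa M -> 1 < #|state M| -> 0 < #|@final A M| < #|state M|.
Proof.
move=> minM gt1.
have const b : ~ (forall q : state M, final q = b).
  move=> finb; pose M1 := @Dfa A unit tt (fun q _ => q) (fun=> b).
  have /minM : lang M1 = lang M.
    by apply: funext => w; rewrite /lang /= finb.
  by rewrite /= card_unit leqNgt gt1.
apply/andP; split.
  rewrite lt0n; apply/eqP => /card0_eq no_final.
  by apply: (const false) => q; have := no_final q; rewrite !inE.
rewrite ltn_neqAle max_card andbT; apply/eqP => all_final.
apply: (const true) => q.
by have := elimT (subset_cardP all_final) (subset_predT _) q; rewrite !inE.
Qed.

(** * The DFA of triples for (L1 o L2) L3 and its number of states *)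

Definition boolfun (o : boolop) : bool -> bool -> bool :=
  match o with Cap => andb | Cup => orb | SymDiff => addb end.

Lemma apply_boolopE o (A : finType) (M1 M2 : dfa A) w :
  apply_boolop o (lang M1) (lang M2) w <->
  boolfun o (final (run (init M1) w)) (final (run (init M2) w)).
Proof.
rewrite /lang; case: o => /=; rewrite -!/(run _ _).
- by split=> [[/= -> ->]|/andP[]].
- by split=> [[/= ->|/= ->]|/orP]; rewrite ?orbT.
- by rewrite /setY /setD /setU /=; case: final; case: final => /=; split; intuition.
Qed.

Section ConcDfa.
Variables (o : boolop) (A : finType) (M1 M2 M3 : dfa A).
Local Notation triple := (state M1 * state M2 * {set state M3})%type.

Definition final_pair (x : state M1 * state M2) : bool :=
  boolfun o (final x.1) (final x.2).

Definition conc_valid (x : triple) : bool :=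
  final_pair x.1 ==> (init M3 \in x.2).

(** At an accepting pair the prefix read so far is in L1 o L2, so a new run of [M3] starts there. *)
Definition conc_saturate i j (S : {set state M3}) : triple :=
  (i, j, if final_pair (i, j) then init M3 |: S else S).

Lemma conc_saturateP i j S : conc_valid (conc_saturate i j S).
Proof. by rewrite /conc_valid /=; case: ifP => //; rewrite !inE eqxx. Qed.

Definition conc_state : finType := {x : triple | conc_valid x}.

Definition conc_mk i j S : conc_state := Sub (conc_saturate i j S) (conc_saturateP i j S).

Definition conc_dfa : dfa A :=
  {| state := conc_state;
     init := conc_mk (init M1) (init M2) finset.set0;
     step := fun s x => conc_mk (step (val s).1.1 x) (step (val s).1.2 x)
                          [set step q x | q in (val s).2];
     final := fun s => [exists q in (val s).2, final q] |}.

(** Induction on the last letter: the empty suffix [v] corresponds to the initial state inserted by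
    saturation, a nonempty one to a step from an earlier element of the set. *)
Lemma run_conc_dfa w :
  let s := val (run (init conc_dfa) w) in
  [/\ s.1 = (run (init M1) w, run (init M2) w) &
      forall q, q \in s.2 <-> exists u v, [/\ w = u ++ v,
        final_pair (run (init M1) u, run (init M2) u) & run (init M3) v = q]].
Proof.
elim/last_ind: w => [|w x]; cbv zeta; last case=> [IH1 IH2].
  split=> //= q; split.
    case: ifP => F; rewrite !inE // orbF => /eqP ->.
    by exists [::], [::].
  move=> [[|? ?] [[|? ?] [//= _]]] /=; rewrite /run /= => -> <-.
  by rewrite !inE eqxx.
rewrite /run !foldl_rcons -!/(run _ _) [val _]/= IH1; split=> //= q.
have sE : (q \in [set step q x | q in (val (run (init conc_dfa) w)).2]) <->
  exists u v, [/\ w = u ++ v,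
     final_pair (run (init M1) u, run (init M2) u) & step (run (init M3) v) x = q].
  split.
    by move=> /imsetP[r /IH2[u [v [-> F <-]] ->]]; exists u, v.
  move=> [u [v [eqw F <-]]]; apply: imset_f; apply/IH2; by exists u, v.
set F := final_pair _; set T := imset _ _ in sE *.
have -> : (q \in (if F then init M3 |: T else T)) =
          (F && (q == init M3)) || (q \in T).
  by case: F; rewrite ?inE.
split.
  case/orP => [/andP[Fw /eqP ->]|/sE[u [v [-> Fu <-]]]].
    exists (rcons w x), [::]; rewrite cats0 /run !foldl_rcons; split=> //.
  by exists u, (rcons v x); rewrite rcons_cat /run foldl_rcons.
move=> [u [v []]]; case/lastP: v => [|v y].
  by rewrite cats0 => <-; rewrite /run !foldl_rcons -!/(run _ _) /F => -> <-;
    rewrite eqxx.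
rewrite -rcons_cat => /rcons_inj[ew ex] Fu eqq; apply/orP; right; apply/sE.
by exists u, v; rewrite -eqq ex /run foldl_rcons.
Qed.

Lemma lang_conc_dfa :
  lang conc_dfa = conc (apply_boolop o (lang M1) (lang M2)) (lang M3).
Proof.
apply/seteqP; split=> [w|w [u /apply_boolopE Fu [v Fv <-]]].
  rewrite /lang /= -/(run _ _) => /existsP[q /andP[]].
  case: (run_conc_dfa w) => _ /(_ q) /= -> [u [v [-> Fu <-]]] Fv.
  by exists u; [apply/apply_boolopE | exists v].
have [_ runP] := run_conc_dfa (u ++ v).
rewrite /lang /= -/(run _ _); apply/existsP; exists (run (init M3) v).
by apply/andP; split=> //; apply/runP; exists u, v.
Qed.

Lemma card_conc_dfa :
  #|state conc_dfa| = (#|state M1| * #|state M2| - #|final_pair|) * 2 ^ #|state M3|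
                      + #|final_pair| * 2 ^ (#|state M3| - 1).
Proof.
rewrite /= card_sig.
have setsE (x : state M1 * state M2) : #|[pred S | conc_valid (x, S)]| =
    if final_pair x then 2 ^ (#|state M3| - 1) else 2 ^ #|state M3|.
  have card_all : #|{set state M3}| = 2 ^ #|state M3|.
    by rewrite -!cardsT -powersetT card_powerset.
  case F: (final_pair x); last first.
    by rewrite -card_all; apply: eq_card => S; rewrite !inE /conc_valid /= F.
  (* The sets avoiding [init M3] are the subsets of its complement, so they are half of all sets,
     and those containing it are the other half. *)
  have <- : #|[pred S : {set state M3} | init M3 \in S]| = 2 ^ (#|state M3| - 1).
    have := cardC [pred S : {set state M3} | init M3 \in S].
    have -> : #|[predC [pred S : {set state M3} | init M3 \in S]]| =
              2 ^ (#|state M3| - 1).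
      rewrite subn1 -(cardsC1 (init M3)) -card_powerset; apply: eq_card => S.
      by rewrite !inE finset.subsetC finset.sub1set !inE.
    rewrite card_all; have : 0 < #|state M3| by apply/card_gt0P; exists (init M3).
    by case: #|state M3| => // p _; rewrite subn1 expnS mul2n -addnn => /addIn.
  by apply: eq_card => S; rewrite !inE /conc_valid /= F.
transitivity (\sum_x #|[pred S | conc_valid (x, S)]|).
  rewrite -sum1_card (eq_bigl (fun y => true && conc_valid (y.1, y.2))).
    rewrite -(pair_big_dep xpredT (fun x S => conc_valid (x, S)) (fun _ _ => 1)) /=.
    by apply: eq_bigr => x _; rewrite sum1_card.
  by case.
rewrite (eq_bigr _ (fun x _ => setsE x)) big_if /= !sum_nat_const addnC.
by rewrite -card_prod -(cardC final_pair) addKn.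
Qed.

Lemma card_final_pair :
  #|final_pair| =
  #|@final A M1| * #|[pred j : state M2 | boolfun o true (final j)]| +
  (#|state M1| - #|@final A M1|) * #|[pred j : state M2 | boolfun o false (final j)]|.
Proof.
have e : #|final_pair| =
    \sum_(i : state M1) #|[pred j : state M2 | boolfun o (final i) (final j)]|.
  rewrite -sum1_card (eq_bigl (fun y => true && final_pair (y.1, y.2))); last by case.
  rewrite -(pair_big_dep xpredT (fun x S => final_pair (x, S)) (fun _ _ => 1)) /=.
  by apply: eq_bigr => x _; rewrite sum1_card.
rewrite e (eq_bigr (fun i => if final i then
     #|[pred j : state M2 | boolfun o true (final j)]| else
     #|[pred j : state M2 | boolfun o false (final j)]|)); last first.
  by move=> i _; case: final.
by rewrite big_if /= !sum_nat_const -(cardC (@final A M1)) addKn.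
Qed.

End ConcDfa.

(** * The upper bound, by minimising the number of accepting pairs *)

Definition boolop_deficit (o : boolop) (m n : nat) : nat :=
  match o with Cap => 1 | Cup => m + n - 1 | SymDiff => m + n - 2 end.

(** Here [f1] and [f2] are the numbers of final states; the value at [f1 = f2 = 1] is the minimum
    [boolop_deficit]. *)
Definition boolop_final_count (o : boolop) (m n f1 f2 : nat) : nat :=
  match o with
  | Cap => f1 * f2
  | Cup => f1 * n + (m - f1) * f2
  | SymDiff => f1 * (n - f2) + (m - f1) * f2
  end.

Lemma boolop_final_card o (A : finType) (M1 M2 : dfa A) :
  #|@final_pair o A M1 M2| =
  boolop_final_count o #|state M1| #|state M2| #|@final A M1| #|@final A M2|.
Proof.
rewrite card_final_pair; set f2 := #|@final A M2|; set n := #|state M2|.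
have -> : #|[pred j : state M2 | boolfun o false (final j)]| =
  if o is Cap then 0 else f2.
  by case: o; [apply: eq_card0 => j | apply: eq_card => j | apply: eq_card => j];
     rewrite inE.
have -> : #|[pred j : state M2 | boolfun o true (final j)]| =
  match o with Cap => f2 | Cup => n | SymDiff => n - f2 end.
  case: o => //=; try by apply: eq_card => j; rewrite inE.
  by rewrite /n -(cardC (@final A M2)) addKn; apply: eq_card => j; rewrite !inE.
by case: o; rewrite ?muln0 ?addn0.
Qed.

Lemma card_conc_dfa_le o (A : finType) (M1 M2 M3 : dfa A) :
  1 < #|state M1| -> 1 < #|state M2| -> minimal_dfa M1 -> minimal_dfa M2 ->
  let k := boolop_deficit o #|state M1| #|state M2| in
  #|state (conc_dfa o M1 M2 M3)| <=
  (#|state M1| * #|state M2| - k) * 2 ^ #|state M3| + k * 2 ^ (#|state M3| - 1).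
Proof.
move=> m1 n1 min1 min2 /=; rewrite card_conc_dfa boolop_final_card.
have := minimal_dfa_final_card min1 m1; have := minimal_dfa_final_card min2 n1.
have : 0 < #|state M3| by apply/card_gt0P; exists (init M3).
move: #|state M1| #|state M2| #|state M3| #|_| #|_| m1 n1 => m n [//|p] f1 f2.
rewrite subn1 expnS /= => m1 n1 _ /andP[f2_gt0 f2_lt] /andP[f1_gt0 f1_lt].
have [le1 le2] : boolop_deficit o m n <= boolop_final_count o m n f1 f2 /\
                 boolop_final_count o m n f1 f2 <= m * n.
  case: f1 f2 f1_gt0 f2_gt0 f1_lt f2_lt => // x [//|y] _ _.
  (* With [f1 = x + 1] and [m = x + 2 + z], and likewise for [f2] and [n], the subtractions
     disappear and both inequalities compare polynomials with natural coefficients. *)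
  move=> /subnKC <- /subnKC <-; move: (m - _) (n - _) => z t.
  rewrite [_ + z]addSnnS [_ + t]addSnnS; case: o => /=; rewrite ?addKn; split; lia.
set f := boolop_final_count _ _ _ _ _ in le1 le2 *.
(* Each accepting pair beyond the minimum contributes 2^(p-1) sets instead of 2^p. *)
rewrite -(subnK le2) addnK -addnBA // mulnDl -addnA leq_add2l.
by rewrite -(subnK le1) addnK mulnDl leq_add2r leq_mul2l leq_pmull ?orbT.
Qed.

(** * The cycle, the transposition and the contraction on a single coordinate *)

Section Cycle.
Variable n : nat.
Implicit Types q r : 'I_n.+3.

Definition swap01 q : 'I_n.+3 :=
  if q == ord0 then inord 1 else if q == inord 1 then ord0 else q.

Definition contract10 q : 'I_n.+3 := if q == inord 1 then ord0 else q.

Lemma val_inord1 : (inord 1 : 'I_n.+3) = 1 :> nat.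
Proof. exact: inordK. Qed.

Lemma inord1_neq0 : (inord 1 == ord0 :> 'I_n.+3) = false.
Proof. by rewrite -val_eqE /= val_inord1. Qed.

Lemma swap01K : involutive swap01.
Proof.
move=> q; rewrite /swap01; case: (eqVneq q ord0) => [->|q0].
  by rewrite inord1_neq0 eqxx.
by case: (eqVneq q (inord 1)) => [->|q1]; rewrite ?eqxx // (negbTE q0) (negbTE q1).
Qed.

Lemma swap01_max q : (swap01 q == ord_max) = (q == ord_max).
Proof.
rewrite /swap01; case: (q =P ord0) => [->|_]; first by rewrite -!val_eqE /= val_inord1.
by case: (q =P inord 1) => [->|_] //; rewrite -!val_eqE /= val_inord1.
Qed.

Lemma ordS_0 : ordS (ord0 : 'I_n.+3) = inord 1.
Proof. by apply/val_inj; rewrite /= val_inord1. Qed.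

Lemma ordS_eq0 q : (ordS q == ord0) = (q == ord_max).
Proof.
rewrite -!val_eqE /=; have := ltn_ord q; rewrite ltnS leq_eqVlt.
case/orP => [/eqP ->|lt]; first by rewrite modnn !eqxx.
by rewrite modn_small // (ltn_eqF lt).
Qed.

Lemma iter_ordS_inj k : injective (iter k (@ordS n.+3)).
Proof. by elim: k => //= k IH q r /ordS_inj/IH. Qed.

Lemma ordS_lt q : q < n.+2 -> ordS q = q.+1 :> nat.
Proof. by move=> lt; rewrite /= modn_small. Qed.

Lemma val_iter_ordS k q : iter k (@ordS n.+3) q = (q + k) %% n.+3 :> nat.
Proof.
elim: k => [|k IH] /=; first by rewrite addn0 modn_small.
by rewrite IH -addn1 modnDml addn1 addnS.
Qed.

Lemma iter_ordS_dvd k q : n.+3 %| k -> iter k (@ordS n.+3) q = q.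
Proof.
move=> /dvdnP[d ->]; apply/val_inj.
by rewrite /= val_iter_ordS addnC modnMDl modn_small.
Qed.

(** The corresponding power of [a] is the word that tests for the state [q]. *)
Lemma iter_ordS_max q r :
  (iter (n.+2 - q) (@ordS n.+3) r == ord_max) = (r == q).
Proof.
rewrite -!val_eqE /= val_iter_ordS; have := ltn_ord q; have := ltn_ord r.
case: (leqP r q) => [le_rq lr lq|lt_qr lr lq]; first by rewrite modn_small; lia.
have -> : r + (n.+2 - q) = (r - q - 1) + n.+3 by lia.
by rewrite modnDr modn_small; lia.
Qed.

Lemma run_nseq_La s2 s3 k q :
  @run letter (X_dfa n.+3 (Some La) s2 s3) q (nseq k La) = iter k (@ordS n.+3) q.
Proof. by elim: k q => // k IH q; rewrite iterSr -IH. Qed.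

Lemma minimal_X_dfa s2 s3 : minimal_dfa (@X_dfa n.+3 letter (Some La) s2 s3).
Proof.
apply: minimal_dfa_of_accessible_separated => [q|q r E].
  exists (nseq q La); rewrite run_nseq_La; apply: ord_inj.
  by rewrite [LHS](val_iter_ordS q ord0) add0n modn_small.
have := E (nseq (n.+2 - q) La); rewrite !run_nseq_La /=.
by rewrite !iter_ordS_max eqxx => /esym/eqP.
Qed.

Definition or1 q : 'I_n.+3 := if q == ord0 then inord 1 else q.
(** Truncated predecessor, in the form realised by backward letters: [or1] is undone by [b] or [c],
    [ord_pred] by [a]. *)
Definition tpred q : 'I_n.+3 := ord_pred (or1 q).

Lemma ord_pred_gt0 q : q != ord0 -> ord_pred q = q.-1 :> nat.
Proof.
rewrite -val_eqE /=; case: q => [[|q] lt] //= _.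
by rewrite modnDr modn_small // ltnW.
Qed.

Lemma val_tpred q : tpred q = q.-1 :> nat.
Proof.
rewrite /tpred /or1; case: eqP => [->|/eqP q0]; last exact: ord_pred_gt0.
by rewrite ord_pred_gt0 ?val_inord1 // -val_eqE /= val_inord1.
Qed.

Lemma tpred_max q : (tpred q == ord_max) = false.
Proof.
apply/eqP => /(congr1 (@nat_of_ord _)); rewrite val_tpred /=.
by have := ltn_ord q; lia.
Qed.

Lemma ord_pred0 : ord_pred ord0 = ord_max :> 'I_n.+3.
Proof. by apply/val_inj; rewrite /= modn_small. Qed.

Lemma imset_ordSK (S : {set 'I_n.+3}) : @ordS n.+3 @: (@ordS n.+3 @^-1: S) = S.
Proof.
apply/setP => q; apply/imsetP/idP => [[r]|qS]; first by rewrite inE => rS ->.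
by exists (ord_pred q); rewrite ?inE ord_predK.
Qed.

Lemma card_preim_ordS (S : {set 'I_n.+3}) : #|@ordS n.+3 @^-1: S| = #|S|.
Proof. by rewrite -{2}(imset_ordSK S) card_imset //; exact: ordS_inj. Qed.

Lemma contract10_id (S : {set 'I_n.+3}) : inord 1 \notin S -> contract10 @: S = S.
Proof.
move=> S1; rewrite -[RHS]imset_id; apply: eq_in_imset => q qS.
by rewrite /contract10; case: eqP => // q1; rewrite -q1 qS in S1.
Qed.

(** Conjugating the transposition by powers of the cycle gives all exchanges of neighbours, which
    push [x] up to the last state. The index [k] counts cycle steps, since these also move the other
    coordinate; after [N] of them it is back. *)
Lemma swap_to_max (P : nat -> 'I_n.+3 -> 'I_n.+3 -> Prop) N :
  n.+3 %| N -> 0 < N ->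
  (forall k q r, P k q r -> P k.+1 (ordS q) (ordS r)) ->
  (forall k q r, P k q r -> P k (swap01 q) (swap01 r)) ->
  (forall q r, P N q r -> P 0 q r) ->
  forall x q r, P 0 q r -> exists q' r',
    [/\ P 0 q' r', (q' == ord_max) = (q == x) & (r' == ord_max) = (r == x)].
Proof.
move=> dvdN N_gt0 PS Pswap PN x q r.
have Piter t k y z : P k y z -> P (t + k) (iter t (@ordS n.+3) y) (iter t (@ordS n.+3) z).
  by elim: t => //= t IH /IH; exact: PS.
have [t] := ubnP (n.+2 - x); elim: t x q r => // t IH x q r lt_t Pqr.
have [->|x_max] := eqVneq x ord_max; first by exists q, r.
have lt_x : x < n.+2 by have := ltn_ord x; move: x_max; rewrite -val_eqE /=; lia.
have le_xN : x <= N by have := dvdn_leq N_gt0 dvdN; lia.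
(* The exchange of [x] and [x + 1], using exactly [N] cycle steps. *)
pose f y := iter x (@ordS n.+3) (swap01 (iter (N - x) (@ordS n.+3) y)).
have f_inj : injective f.
  by move=> y z; rewrite /f => /iter_ordS_inj/(inv_inj (@swap01K))/iter_ordS_inj.
have fx : f x = ordS x.
  rewrite /f; have -> : iter (N - x) (@ordS n.+3) x = ord0.
    by apply: ord_inj; rewrite val_iter_ordS subnKC //; apply/eqP.
  rewrite /swap01 eqxx; apply: ord_inj; rewrite val_iter_ordS val_inord1 add1n.
  by rewrite (ordS_lt lt_x) modn_small.
have Pf : P 0 (f q) (f r).
  have := Piter x _ _ _ (Pswap _ _ _ (Piter (N - x) 0 _ _ Pqr)).
  by rewrite addn0 subnKC //; exact: PN.
have [|q' [r' [Pqr' eq er]]] := IH (ordS x) _ _ _ Pf.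
  by rewrite (ordS_lt lt_x); lia.
by exists q', r'; rewrite eq er -fx !(inj_eq f_inj).
Qed.

End Cycle.

(** * The witness: transitions on triples and backward steps *)

Section Witness.
Variables (o : boolop) (m n p : nat).
Local Notation M1 := (@X_dfa m.+3 letter (Some La) (Some Lb) None).
Local Notation M2 := (@X_dfa n.+3 letter (Some La) (Some Lc) None).
Local Notation M3 := (@X_dfa p.+3 letter (Some La) None (Some Lb)).
Local Notation M := (conc_dfa o M1 M2 M3).
Implicit Types (i : 'I_m.+3) (j : 'I_n.+3) (S T : {set 'I_p.+3}).

Definition accepting i j : bool := boolfun o (i == ord_max) (j == ord_max).

Definition saturate i j S : {set 'I_p.+3} := if accepting i j then ord0 |: S else S.

Lemma val_stepE (s : state M) x i j S : val s = (i, j, S) ->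
  val (step s x) = match x with
    | La => (ordS i, ordS j, saturate (ordS i) (ordS j) (@ordS p.+3 @: S))
    | Lb => (swap01 i, j, saturate (swap01 i) j (@contract10 p @: S))
    | Lc => (i, swap01 j, saturate i (swap01 j) S)
    end.
Proof.
case: s => [[[i' j'] X] v] /= [-> -> ->]; case: x => //=.
congr (_, _); rewrite /saturate /accepting /conc_saturate /=; set T := imset _ _.
by have -> : T = S by exact: imset_id.
Qed.

Definition reach i j S : Prop := exists w, val (run (init M) w) = (i, j, S).

Definition valid i j S : bool := accepting i j ==> (ord0 \in S).

Lemma saturate_valid i j S : valid i j S -> saturate i j S = S.
Proof.
rewrite /valid /saturate; case: accepting => //= S0.
by apply/finset.setUidPr; rewrite finset.sub1set.
Qed.

Lemma reach_step i j S x : reach i j S ->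
  exists2 s : state M, val s = (i, j, S) &
    let: (i', j', S') := val (step s x) in reach i' j' S'.
Proof.
move=> [w ws]; exists (run (init M) w) => //.
case E: (val _) => [[i' j'] S']; exists (rcons w x).
by rewrite /run foldl_rcons.
Qed.

Lemma reach_pred i j S T :
  saturate i j (@ordS p.+3 @: T) = S -> reach (ord_pred i) (ord_pred j) T -> reach i j S.
Proof.
move=> eS /(reach_step La)[s es].
by rewrite (val_stepE La es) !ord_predK eS.
Qed.

Lemma reach_b i j S :
  valid i j S -> inord 1 \notin S -> reach (swap01 i) j S -> reach i j S.
Proof.
move=> v S1 /(reach_step Lb)[s es].
by rewrite (val_stepE Lb es) swap01K contract10_id // saturate_valid.
Qed.

Lemma reach_c i j S : valid i j S -> reach i (swap01 j) S -> reach i j S.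
Proof.
move=> v /(reach_step Lc)[s es].
by rewrite (val_stepE Lc es) swap01K saturate_valid.
Qed.

Lemma or1_swap01 k (q : 'I_k.+3) : or1 q = if q == ord0 then swap01 q else q.
Proof. by rewrite /or1 /swap01; case: eqP. Qed.

Lemma or1_max k (q : 'I_k.+3) : (or1 q == ord_max) = (q == ord_max).
Proof. by rewrite or1_swap01; case: ifP => // _; rewrite swap01_max. Qed.

Lemma reach_c_or1 i j S : valid i j S -> reach i (or1 j) S -> reach i j S.
Proof. by move=> v; rewrite or1_swap01; case: ifP => // _; exact: reach_c. Qed.

(** The basic backward step: [c] and [b] turn zero coordinates into 1, then [a] is undone. Undoing
    [b] needs 1 outside [S], hence the condition on [i]. *)
Lemma reach_tpred i j S T : valid i j S -> (inord 1 \in S -> i != ord0) ->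
  saturate i j (@ordS p.+3 @: T) = S -> reach (tpred i) (tpred j) T -> reach i j S.
Proof.
move=> v i0 eS r.
have {r} : reach (or1 i) (or1 j) S.
  by apply: reach_pred r; rewrite -eS /saturate /accepting !or1_max.
move=> r; apply: reach_c_or1 => //.
move: r; rewrite {1}or1_swap01; case: eqP => // i_0; apply: reach_b.
  by rewrite /valid /accepting or1_max.
by apply/negP => /i0; rewrite i_0 eqxx.
Qed.

Lemma accepting_tpred i j : accepting (tpred i) (tpred j) = false.
Proof. by rewrite /accepting !tpred_max; case: o. Qed.

Lemma valid_nonfinal i j S : accepting i j = false -> valid i j S.
Proof. by rewrite /valid => ->. Qed.

(** * Reachability of every triple *)

Lemma reach_empty i j : accepting i j = false -> reach i j finset.set0.
Proof.
have [k] := ubnP (i + j); elim: k i j => // k IH i j lt F.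
have [ij0|ij] := posnP (i + j).
  exists [::]; rewrite /= /conc_saturate /=.
  have -> : i = ord0 by apply/val_inj => /=; lia.
  have -> : j = ord0 by apply/val_inj => /=; lia.
  by congr (_, _); rewrite /final_pair; case: o.
apply: (@reach_tpred _ _ _ finset.set0); rewrite ?inE ?valid_nonfinal //.
  by rewrite /saturate F imset0.
by apply: IH; rewrite ?accepting_tpred // !val_tpred; lia.
Qed.

(** The forward [a] into an accepting pair inserts 0 by itself, so 0 can be removed from [S] before
    stepping back. *)
Lemma reach_final s :
  (forall i j S, #|S| < s -> valid i j S -> reach i j S) ->
  forall i j S, #|S| = s -> accepting i j -> ord0 \in S -> reach i j S.
Proof.
move=> IH i j S cS F S0; pose T := @ordS p.+3 @^-1: (S :\ ord0).
have cT : #|T| < s by rewrite card_preim_ordS -cS (cardsD1 ord0 S) S0.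
have eT : saturate i j (@ordS p.+3 @: T) = S by rewrite /saturate F imset_ordSK finset.setD1K.
have v : valid i j S by rewrite /valid S0 implybT.
case S1: (inord 1 \in S); last first.
  by apply: reach_tpred eT _; rewrite ?S1 //; apply: IH;
     rewrite ?valid_nonfinal ?accepting_tpred.
(* As 1 is in [S], the predecessor set contains 0 and is valid whether or not its pair is
   accepting. *)
apply: reach_pred eT _; apply: IH => //.
rewrite /valid !inE ordS_0 S1 andbT.
by rewrite -val_eqE /= val_inord1 implybT.
Qed.

(** Backward rotation preserves the size of [S]. The induction is on a bound for [j], then on [i],
    and at [i = 0] on the number [t] of backward steps that bring 1 into [S]. *)
Lemma reach_nonfinal s : 0 < s ->
  (forall i j S, #|S| = s -> accepting i j -> ord0 \in S -> reach i j S) ->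
  forall i j S, #|S| = s -> accepting i j = false -> reach i j S.
Proof.
move=> s_gt0 IHF i j; have [k] := ubnP j; elim: k i j => // k IHk i j lt_jk S cS F.
have shiftP i' j' S' : accepting i' j' = false ->
    saturate i' j' (@ordS p.+3 @: (@ordS p.+3 @^-1: S')) = S'.
  by rewrite /saturate imset_ordSK => ->.
(* The obstructed case: undoing [a] sends the first coordinate to the last state and puts 0 into the
   set. *)
have suff_i0 j' S' : j' <= k -> #|S'| = s -> accepting ord0 j' = false ->
    inord 1 \in S' -> reach ord0 j' S'.
  move=> le_j' cS' F' S1; have v := valid_nonfinal S' F'.
  have S0 : ord0 \in @ordS p.+3 @^-1: S' by rewrite inE ordS_0.
  have i0E : (ord0 == ord_max :> 'I_m.+3) = false by [].
  have back jj : accepting ord0 jj = false ->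
      reach ord_max (ord_pred jj) (@ordS p.+3 @^-1: S') -> reach ord0 jj S'.
    by move=> F0 r; apply: reach_pred (shiftP _ _ _ F0) _; rewrite ord_pred0.
  have last jj : accepting ord0 jj = false ->
      accepting ord_max (ord_pred jj) -> reach ord0 jj S'.
    by move=> F0 F1; apply: back => //; apply: IHF; rewrite // card_preim_ordS.
  case eo: o.
  (* For the intersection, [j'] at most 1 can be made 0, whose predecessor is the last state; a
     larger [j'] just decreases, and the outer induction applies although [i] has grown. *)
  - have [j1|j_gt1] := leqP j' 1.
      case: (eqVneq j' ord0) => [j0|j0].
        by apply: last => //; rewrite j0 ord_pred0 /accepting eo !eqxx.
      have j'1 : swap01 j' = ord0.
        rewrite /swap01 (negbTE j0); suff -> : j' = inord 1 by rewrite eqxx.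
        by apply: ord_inj; rewrite val_inord1; move: j0; rewrite -val_eqE /=; lia.
      apply: reach_c => //; rewrite j'1; apply: last; first by rewrite /accepting eo.
      by rewrite ord_pred0 /accepting eo !eqxx.
    have j'0 : j' != ord0 by rewrite -val_eqE /=; lia.
    have ltj' := ltn_ord j'.
    apply: back => //; apply: IHk; rewrite ?card_preim_ordS ?ord_pred_gt0 //; first lia.
    rewrite /accepting eo eqxx /=; apply/eqP => /(congr1 (@nat_of_ord _)).
    by rewrite ord_pred_gt0 //=; lia.
  - by apply: last => //; rewrite /accepting eo eqxx.
  (* For the symmetric difference the second coordinate must avoid the last state, so a zero is
     first replaced by 1. *)
  - apply: reach_c_or1 => //; apply: last; first by rewrite /accepting or1_max.
    by rewrite -/(tpred j') /accepting tpred_max eo eqxx.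
have shrink i' j' S' : accepting i' j' = false -> (inord 1 \in S' -> i' != ord0) ->
    reach (tpred i') (tpred j') (@ordS p.+3 @^-1: S') -> reach i' j' S'.
  by move=> F' ?; apply: reach_tpred => //; [exact: valid_nonfinal | exact: shiftP].
have tpredj (j' : 'I_n.+3) : j' < k.+1 -> tpred j' < k.+1.
  by rewrite val_tpred; exact: leq_ltn_trans (leq_pred _).
have [l ei] : exists l, l = i :> nat by exists i.
elim: l i ei j S lt_jk cS F => [|l IHl] i ei j S lt_jk cS F; last first.
  apply: shrink => //; first by rewrite -val_eqE /= -ei.
  apply: IHl; rewrite ?card_preim_ordS ?accepting_tpred ?val_tpred -?ei //.
  by rewrite -val_tpred tpredj.
have i0 : i = ord0 by apply: ord_inj; rewrite -ei.
rewrite {i ei}i0 in F *.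
have [t tS] : exists t, iter t (@ordS p.+3) (inord 1) \in S.
  have /card_gt0P[q qS] : 0 < #|S| by rewrite cS.
  (* Modulo [p + 3] this is [q - 1], the number of steps from 1 to [q]. *)
  exists (q + p.+2); suff -> : iter (q + p.+2) (@ordS p.+3) (inord 1) = q by [].
  apply: ord_inj; rewrite val_iter_ordS val_inord1 addnCA add1n modnDr.
  by rewrite modn_small.
elim: t j S lt_jk cS F tS => [|t IHt] j S lt_jk cS F tS; first exact: suff_i0.
case S1: (inord 1 \in S); first exact: suff_i0.
apply: shrink => //; first by rewrite S1.
have -> : tpred ord0 = ord0 :> 'I_m.+3 by apply: ord_inj; rewrite val_tpred.
apply: IHt; rewrite ?card_preim_ordS ?tpredj ?inE //.
by rewrite /accepting tpred_max; case: o.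
Qed.

Lemma reach_valid i j S : valid i j S -> reach i j S.
Proof.
have [k] := ubnP #|S|; elim: k i j S => // k IH i j S lt v.
have IHF : forall i j T, #|T| = #|S| -> accepting i j -> ord0 \in T -> reach i j T.
  apply: reach_final => i' j' T' lt'; apply: IH; exact: leq_trans lt' _.
case F: (accepting i j); first by apply: IHF => //; move: v; rewrite /valid F.
have [S0|S_gt0] := posnP #|S|; last exact: reach_nonfinal S_gt0 IHF _ _ _ _ F.
by rewrite (cards0_eq S0); exact: reach_empty.
Qed.

(** * Separation of distinct triples *)

Lemma final_run_nseq_La (s : state M) r t : r + t = p.+2 ->
  final (run s (nseq t La)) = ((inord r : 'I_p.+3) \in (val s).2).
Proof.
elim: t r s => [|t IH] r s.
  rewrite addn0 => ->; have -> : inord p.+2 = ord_max :> 'I_p.+3.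
    by apply: ord_inj; rewrite inordK.
  apply/existsP/idP => [[q /andP[qS /eqP <-]] //|maxS].
  by exists ord_max; rewrite maxS /=.
rewrite addnS -addSn => er; rewrite [LHS](IH r.+1 (step s La)) //.
case es: (val s) => [[i j] X]; rewrite (val_stepE La es) /=.
have -> : inord r.+1 = ordS (inord r) :> 'I_p.+3.
  by apply: ord_inj; rewrite ordS_lt !inordK //; lia.
(* Saturation may insert 0, but here [r + 1] is at most [p + 2] and hence not 0 in the cycle, so its
   membership is unaffected. *)
rewrite /saturate; case: ifP => _; rewrite ?inE mem_imset //; try exact: ordS_inj.
by rewrite ordS_eq0 -val_eqE /= inordK; lia.
Qed.

Lemma indist_snd (s s' : state M) : indist s s' -> (val s).2 = (val s').2.
Proof.
move=> E; apply/setP => q; have := E (nseq (p.+2 - q) La).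
have eq : q + (p.+2 - q) = p.+2 by have := ltn_ord q; lia.
by rewrite !(final_run_nseq_La _ eq) inord_val.
Qed.

(** After [k] rounds of [abb] every state in the set is 0 or larger than [k]:
    0 goes to 1 and is contracted back, so it absorbs each state that wraps. *)
Definition high k S : Prop := forall q, q \in S -> q = ord0 \/ k < q.

(** Keeps the two pairs and forgets the common set except for [high], so that letters act on pairs
    alone. *)
Definition confusable k i j i' j' : Prop := exists s s' : state M, exists S,
  [/\ indist s s', val s = (i, j, S), val s' = (i', j', S) & high k S].

Lemma confusableP k (s s' : state M) i j i' j' S S' :
  indist s s' -> val s = (i, j, S) -> val s' = (i', j', S') -> high k S ->
  confusable k i j i' j'.
Proof.
move=> E es es' h; exists s, s', S; split=> //.
by have := indist_snd E; rewrite es es' /= => ->.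
Qed.

Lemma high_saturate k i j S : high k S -> high k (saturate i j S).
Proof.
by rewrite /saturate; case: ifP => // _ h q; rewrite !inE => /orP[/eqP|/h]; [left|].
Qed.

Lemma high_contract10 k S : (forall q, q \in S -> q = inord 1 \/ q = ord0 \/ k < q) ->
  high k (@contract10 p @: S).
Proof.
move=> h q /imsetP[r /h rS ->]; rewrite /contract10.
by case: eqP => [_|r1]; [left | case: rS].
Qed.

Lemma confusable_b k i j i' j' :
  confusable k i j i' j' -> confusable k (swap01 i) j (swap01 i') j'.
Proof.
move=> [s [s' [S [E es es' h]]]].
apply: (confusableP (indist_step Lb E)).
- exact: val_stepE es.
- exact: val_stepE es'.
by apply: high_saturate; apply: high_contract10 => q /h; right.
Qed.

Lemma confusable_c k i j i' j' :
  confusable k i j i' j' -> confusable k i (swap01 j) i' (swap01 j').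
Proof.
move=> [s [s' [S [E es es' h]]]].
apply: (confusableP (indist_step Lc E)).
- exact: val_stepE es.
- exact: val_stepE es'.
exact: high_saturate.
Qed.

(** The two [b] cancel on the first coordinate, while the contraction returns to 0 what [a] moved to
    1; all other states move up or wrap to 0. *)
Lemma confusable_abb k i j i' j' :
  confusable k i j i' j' -> confusable k.+1 (ordS i) (ordS j) (ordS i') (ordS j').
Proof.
move=> [s [s' [S [E es es' h]]]].
rewrite -[ordS i]swap01K -[ordS i']swap01K; apply: confusable_b.
have ea := val_stepE La es; have ea' := val_stepE La es'.
apply: (confusableP (indist_step Lb (indist_step La E))).
- exact: val_stepE ea.
- exact: val_stepE ea'.
apply: high_saturate; apply: high_contract10 => q.
have hS : q \in @ordS p.+3 @: S -> q = inord 1 \/ q = ord0 \/ k.+1 < q.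
  move=> /imsetP[r /h[-> ->|lt_kr ->]]; first by left; exact: ordS_0.
  have [r_max|r_max] := eqVneq r ord_max.
    by right; left; apply/eqP; rewrite ordS_eq0 r_max.
  right; right; rewrite ordS_lt //.
  by have := ltn_ord r; move: r_max; rewrite -val_eqE /=; lia.
by rewrite /saturate; case: ifP => // _; rewrite !inE => /orP[/eqP ->|//]; right; left.
Qed.

Lemma confusableW k i j i' j' : confusable k.+1 i j i' j' -> confusable k i j i' j'.
Proof.
move=> [s [s' [S [E es es' h]]]]; exists s, s', S; split=> // q /h[]; first by left.
by right; exact: ltnW.
Qed.

(** No state exceeds [p + 2], so the set is within {0}. After [a], the state 0 can only come from
    saturation, and its presence tells whether the new pair is accepting. *)
Lemma confusable_accepting_ordS i j i' j' : confusable p.+2 i j i' j' ->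
  accepting (ordS i) (ordS j) = accepting (ordS i') (ordS j').
Proof.
move=> [s [s' [S [E es es' h]]]].
have S0 : ord0 \notin @ordS p.+3 @: S.
  apply/imsetP => -[q /h[->|]]; first by rewrite ordS_0 => /esym/eqP; rewrite inord1_neq0.
  by have := ltn_ord q; lia.
have := indist_snd (indist_step La E).
rewrite (val_stepE La es) (val_stepE La es') /=.
move=> /setP/(_ ord0); rewrite /saturate.
by do 2!case: ifP => _; rewrite ?inE ?eqxx ?(negbTE S0).
Qed.

Lemma confusable_iter t k i j i' j' : confusable k i j i' j' ->
  confusable (t + k) (iter t (@ordS _) i) (iter t (@ordS _) j)
    (iter t (@ordS _) i') (iter t (@ordS _) j').
Proof. by move=> h; elim: t => //= t; exact: confusable_abb. Qed.

Lemma confusable_iterW t k i j i' j' : confusable k i j i' j' ->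
  confusable k (iter t (@ordS _) i) (iter t (@ordS _) j)
    (iter t (@ordS _) i') (iter t (@ordS _) j').
Proof. by move=> h; elim: t => //= t IH; apply: confusableW; exact: confusable_abb. Qed.

Local Notation period := (m.+3 * n.+3).

Lemma iter_period1 i : iter period (@ordS _) i = i.
Proof. by rewrite iter_ordS_dvd ?dvdn_mulr. Qed.

Lemma iter_period2 j : iter period (@ordS _) j = j.
Proof. by rewrite iter_ordS_dvd ?dvdn_mull. Qed.

Lemma confusable_accepting i j i' j' :
  confusable p.+2 i j i' j' -> accepting i j = accepting i' j'.
Proof.
(* These rounds of [abb] followed by a single [a] move each coordinate through a whole number of
   cycles. *)
move=> /(confusable_iterW period.-1)/confusable_accepting_ordS.
by rewrite -!iterS prednK // !iter_period1 !iter_period2.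
Qed.

Lemma confusable_to_max1 x i j i' j' : confusable p.+2 i j i' j' ->
  exists y y', [/\ confusable p.+2 y j y' j',
    (y == ord_max) = (i == x) & (y' == ord_max) = (i' == x)].
Proof.
apply: (@swap_to_max _ (fun k y y' => confusable p.+2 y (iter k (@ordS _) j)
                                         y' (iter k (@ordS _) j')) period).
- exact: dvdn_mulr.
- by [].
- by move=> k y y' h; apply: confusableW; exact: confusable_abb.
- by move=> k y y'; exact: confusable_b.
- by move=> y y'; cbv beta; rewrite !iter_period2.
Qed.

Lemma confusable_to_max2 x i j i' j' : confusable p.+2 i j i' j' ->
  exists y y', [/\ confusable p.+2 i y i' y',
    (y == ord_max) = (j == x) & (y' == ord_max) = (j' == x)].
Proof.
apply: (@swap_to_max _ (fun k y y' => confusable p.+2 (iter k (@ordS _) i) y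
                                         (iter k (@ordS _) i') y') period).
- exact: dvdn_mull.
- by [].
- by move=> k y y' h; apply: confusableW; exact: confusable_abb.
- by move=> k y y'; exact: confusable_c.
- by move=> y y'; cbv beta; rewrite !iter_period1.
Qed.

Lemma ord_third k (q r : 'I_k.+3) : exists x, (q == x) = false /\ (r == x) = false.
Proof.
have /card_gt0P[x] : 0 < #|~: [set q; r]|.
  by rewrite cardsCs finset.setCK cards2 card_ord; case: (q != r); lia.
by rewrite !inE negb_or ![x == _]eq_sym => /andP[/negbTE ? /negbTE ?]; exists x.
Qed.

Lemma confusable_eq i j i' j' : confusable p.+2 i j i' j' -> i = i' /\ j = j'.
Proof.
move=> C; split; apply/esym/eqP; apply: contraT => /negbTE neq.
  have [y [y' [C1 ey ey']]] := confusable_to_max1 i C.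
  rewrite eqxx in ey; rewrite neq in ey'.
  (* The first coordinates now differ in being last. For the intersection the second one is made
     last along with [j]; otherwise a third state [x] is moved there, so that neither second
     coordinate is last. *)
  have [x [x1 x2]] := ord_third j j'.
  have [z [z' [/confusable_accepting + ez ez']]] :=
    confusable_to_max2 (if o is Cap then j else x) C1.
  by move: ez ez'; rewrite /accepting ey ey'; case: o => -> ->; rewrite /= ?eqxx ?x1 ?x2.
have [y [y' [C1 ey ey']]] := confusable_to_max2 j C.
  rewrite eqxx in ey; rewrite neq in ey'.
have [x [x1 x2]] := ord_third i i'.
have [z [z' [/confusable_accepting + ez ez']]] :=
    confusable_to_max1 (if o is Cap then i else x) C1.
by move: ez ez'; rewrite /accepting ey ey'; case: o => -> ->; rewrite /= ?eqxx ?x1 ?x2 ?andbF.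
Qed.

Lemma minimal_conc_witness : minimal_dfa M.
Proof.
apply: minimal_dfa_of_accessible_separated => [q|s s' E].
  case eq: (val q) => [[i j] X]; have [|w ew] := @reach_valid i j X.
    have := valP q; rewrite eq; exact.
  by exists w; apply: val_inj; rewrite eq.
apply: val_inj; have := indist_snd E.
case es: (val s) => [[i j] X]; case es': (val s') => [[i' j'] X'] /= eX.
(* At [k = 0] the condition [high] holds for every set. *)
have : confusable 0 i j i' j'.
  by apply: (confusableP E es es') => q _;
    case: (posnP q) => [q0|]; [left; apply: ord_inj|right].
move=> /(confusable_iter p.+2); rewrite addn0 => /confusable_eq[].
by move=> /iter_ordS_inj -> /iter_ordS_inj ->; rewrite eX.
Qed.

End Witness.

Theorem theorem3 (o : boolop) (m n p : nat)
    (hm : 3 <= m) (hn : 3 <= n) (hp : 3 <= p) :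
  let k := match o with
           | Cap => 1
           | Cup => m + n - 1
           | SymDiff => m + n - 2
           end in
  let N := (m * n - k) * 2 ^ p + k * 2 ^ (p - 1) in
  let L1 := lang (X_dfa m (Some La) (Some Lb) None) in
  let L2 := lang (X_dfa n (Some La) (Some Lc) None) in
  let L3 := lang (X_dfa p (Some La) None (Some Lb)) in
  has_sc_op (boolop_conc o) m n p N /\
  [/\ has_sc L1 m, has_sc L2 n, has_sc L3 p &
      has_sc (boolop_conc o L1 L2 L3) N].
Proof.
move=> k N L1 L2 L3.
have scX d s2 s3 : 3 <= d -> has_sc (lang (@X_dfa d letter (Some La) s2 s3)) d.
  case: d => [|[|[|d]]] // _; exists (X_dfa d.+3 (Some La) s2 s3).
  by split; rewrite ?card_ord //; exact: minimal_X_dfa.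
have kE : k = boolop_deficit o m n by [].
have witness : [/\ has_sc L1 m, has_sc L2 n, has_sc L3 p &
                   has_sc (boolop_conc o L1 L2 L3) N].
  split; [exact: scX | exact: scX | exact: scX |].
  rewrite /N kE {scX kE N k}/L1 {}/L2 {}/L3.
  case: m n p hm hn hp => [|[|[|m]]] // [|[|[|n]]] // [|[|[|p]]] // _ _ _.
  exists (conc_dfa o (X_dfa m.+3 (Some La) (Some Lb) None)
    (X_dfa n.+3 (Some La) (Some Lc) None) (X_dfa p.+3 (Some La) None (Some Lb))).
  split; [exact: lang_conc_dfa | exact: minimal_conc_witness |].
  (* Each witness has one final state, so the number of accepting pairs is the minimum. *)
  rewrite card_conc_dfa boolop_final_card /= !card_ord.
  have card_final d : #|fun q : 'I_d.+3 => q == ord_max| = 1 by exact: card1.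
  rewrite !card_final; suff -> : boolop_final_count o m.+3 n.+3 1 1 =
    boolop_deficit o m.+3 n.+3 by [].
  by case: o => //=; lia.
split=> //; split; first by exists letter, L1, L2, L3.
move=> A K1 K2 K3 [M1 [<- min1 c1]] [M2 [<- min2 c2]] [M3 [<- min3 c3]].
(* For arbitrary arguments the DFA of triples gives both regularity and the bound. *)
have [N' scN' leN'] := has_sc_of_lang (conc_dfa o M1 M2 M3).
exists N'; first by rewrite /boolop_conc -lang_conc_dfa.
apply: leq_trans leN' _; rewrite /N kE -c1 -c2 -c3.
by apply: card_conc_dfa_le => //; rewrite ?c1 ?c2 ltnW.
Qed.
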